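(* Let $r\ge 3$ be an integer, and let $G_0$ be a $K_r$-free finite simple graph. Then for every integer $k\ge r+1$, $$\tau_{K_k}(G_0)\ge k-r+2.$$
   Context: All graphs are finite and simple. A matching is a set of pairwise vertex-disjoint edges; $V(M)$ denotes the set of endpoints of the edges of $M$. Degree-preserving Builder--Chooser game started from a graph $G_0$: it is played in rounds $t=1,2,\dots$. In round $t$ the current graph is $G_{t-1}=(V,E)$. (i) Builder chooses a matching $M\subseteq E$ and forms the intermediate graph $G^+$ by deleting the edges of $M$, adding a new vertex $w$, and joining $w$ to every vertex of $V(M)$ (a DPG step). (ii) Builder chooses a partition of $E(G^+)$ into two disjoint sets $E^{(0)}\sqcup E^{(1)}$. (iii) Chooser selects $i\in\{0,1\}$, and $G_t:=(V(G^+),E^{(i)})$. For graphs $H$ and $G_0$, the forcing time $\tau_H(G_0)$ is the least $T\ge 0$ such that Builder has a strategy in the game started from $G_0$ guaranteeing that $G_t$ contains $H$ as a (not necessarily induced) subgraph for some $0\le t\le T$; $\tau_H(G_0)=\infty$ if there is no such $T$, i.e. if Chooser can avoid $H$ forever. *)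

(* Defs.v *)
From mathcomp Require Import all_boot.
From mathcomp Require Import boolp.

Set Implicit Arguments.
Unset Strict Implicit.
Unset Printing Implicit Defensive.

Record sgraph := SGraph {
  vertices : finType;
  edges : {set {set vertices}};
  card_edge : forall e, e \in edges -> #|e| = 2
}.

Lemma complete_card_edge (n : nat) (e : {set 'I_n}) :
  e \in [set e : {set 'I_n} | #|e| == 2] -> #|e| = 2.
Proof. by rewrite inE => /eqP. Qed.

Definition complete_graph (n : nat) : sgraph := SGraph (@complete_card_edge n).

Definition contains_subgraph (G H : sgraph) : Prop :=
  exists2 f : vertices H -> vertices G,
    injective f & forall e, e \in edges H -> f @: e \in edges G.

Definition is_matching (G : sgraph) (M : {set {set vertices G}}) : bool :=
  (M \subset edges G) && trivIset M.

(* The new vertex w is [None]; [cover M] is the set of endpoints V(M). *)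
Definition dpg_edges (G : sgraph) (M : {set {set vertices G}}) :
    {set {set option (vertices G)}} :=
  [set Some @: (e : {set vertices G}) | e in edges G :\: M] :|:
  [set [set None; Some x] | x in cover M].

Lemma dpg_card_edge (G : sgraph) (M : {set {set vertices G}}) e :
  e \in dpg_edges M -> #|e| = 2.
Proof.
case/setUP => /imsetP[x].
  case/setDP => xG _ ->; rewrite card_imset; last exact: Some_inj.
  exact: card_edge xG.
by move=> _ ->; rewrite cards2.
Qed.

Definition dpg_step (G : sgraph) (M : {set {set vertices G}}) : sgraph :=
  SGraph (@dpg_card_edge G M).

(* [part false] and [part true] are E^(0) and E^(1); either may be empty. *)
Record builder_move (G : sgraph) := BuilderMove {
  matching : {set {set vertices G}};
  matchingP : is_matching matching;
  part : bool -> {set {set vertices (dpg_step matching)}};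
  part_cover : part false :|: part true = edges (dpg_step matching);
  part_disjoint : [disjoint part false & part true]
}.

Lemma part_card_edge (G : sgraph) (m : builder_move G) (i : bool) e :
  e \in part m i -> #|e| = 2.
Proof.
move=> em; apply: (@card_edge (dpg_step (matching m))).
by rewrite -part_cover inE; case: i em => ->; rewrite ?orbT.
Qed.

Definition chooser_select (G : sgraph) (m : builder_move G) (i : bool) : sgraph :=
  SGraph (@part_card_edge G m i).

(* A move may depend on the current graph and on Chooser's earlier answers;
   for a fixed start and a fixed strategy these answers determine the whole
   history of the game. *)
Definition builder_strategy : Type :=
  seq bool -> forall G : sgraph, builder_move G.

(* Chooser's answer in round t is [c t.-1]. *)
Fixpoint game_graph (s : builder_strategy) (G0 : sgraph) (c : nat -> bool)
    (t : nat) : sgraph :=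
  if t is t'.+1 then
    chooser_select (s (mkseq c t') (game_graph s G0 c t')) (c t')
  else G0.

Definition builder_forces (H G0 : sgraph) (T : nat) : Prop :=
  exists s : builder_strategy, forall c : nat -> bool,
    exists2 t, t <= T & contains_subgraph (game_graph s G0 c t) H.

(* [None] stands for infinity. *)
Definition forcing_time (H G0 : sgraph) : option nat :=
  match pselect (exists T, `[< builder_forces H G0 T >]) with
  | left forced => Some (ex_minn forced)
  | right _ => None
  end.

Definition leq_infty (n : nat) (x : option nat) : bool :=
  if x is Some m then n <= m else true.

(* Main.v *)
(** A clique of [G_t] that avoids the new vertex [w] is a clique of [G_(t-1)],
so a round raises the clique number by at most one. The saving of one over the
first two rounds comes from round 2: with [w1], [w2] the vertices added in
rounds 1 and 2, every clique of [G_2] on at least [r+1] vertices contains both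
[w1] and [w2], hence uses the edge [w1 w2]. That edge lies in only one part of
Builder's partition, and Chooser selects the other one. *)

Require Import Defs.
From mathcomp Require Import all_boot.
From mathcomp Require Import boolp.

Set Implicit Arguments.
Unset Strict Implicit.
Unset Printing Implicit Defensive.

Definition is_clique (G : sgraph) (S : {set vertices G}) : Prop :=
  {in S &, forall x y, x != y -> [set x; y] \in edges G}.

(** Freeness of [complete_graph n], phrased with vertex sets so that cliques can be pulled back
    along [Some]. *)
Definition cliques_below (G : sgraph) (n : nat) : Prop :=
  forall S : {set vertices G}, is_clique S -> #|S| < n.

Lemma cliques_below_leq (G : sgraph) (m n : nat) :
  m <= n -> cliques_below G m -> cliques_below G n.
Proof. by move=> le_mn Gm S /Gm/leq_trans; apply. Qed.

Lemma cliques_belowP (G : sgraph) (n : nat) :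
  cliques_below G n <-> ~ contains_subgraph G (complete_graph n).
Proof.
split=> [Gn [f f_inj fE] | Gn S clS].
  suff /Gn : is_clique (f @: [set: 'I_n]).
    by rewrite card_imset // cardsT card_ord ltnn.
  move=> _ _ /imsetP[i _ ->] /imsetP[j _ ->]; rewrite (inj_eq f_inj) => ne_ij.
  rewrite -(imset_set1 f i) -(imset_set1 f j) -imsetU; apply: fE.
  by rewrite inE cards2 ne_ij.
rewrite ltnNge; apply/negP => le_nS; apply: Gn.
pose f (i : vertices (complete_graph n)) := enum_val (widen_ord le_nS i).
have f_inj : injective f.
  by move=> i j /enum_val_inj/(congr1 val) /= /val_inj.
exists f => // e /[!inE] /cards2P[i [j [ne_ij ->]]].
by rewrite imsetU !imset_set1; apply: clS; rewrite ?enum_valP ?inj_eq.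
Qed.

Lemma dpg_edge_Some (G : sgraph) (M : {set {set vertices G}})
    (x y : vertices G) :
  [set Some x; Some y] \in dpg_edges M -> [set x; y] \in edges G.
Proof.
have -> : [set Some x; Some y] = Some @: [set x; y].
  by rewrite imsetU !imset_set1.
case/setUP => /imsetP[z].
  by case/setDP=> zG _ /(imset_inj Some_inj) ->.
(* An edge added at the new vertex contains [None], which is not in the image of [Some]. *)
by move=> _ /setP/(_ None); rewrite set21 => /imsetP[].
Qed.

Lemma chooser_edge (G : sgraph) (m : builder_move G) (i : bool) e :
  e \in part m i -> e \in dpg_edges (matching m).
Proof.
move=> em; have /setP/(_ e) := part_cover m.
by rewrite inE => <-; case: i em => ->; rewrite ?orbT.
Qed.

Lemma clique_preim (G : sgraph) (m : builder_move G) (i : bool)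
    (S : {set vertices (chooser_select m i)}) :
  is_clique S -> is_clique (Some @^-1: S : {set vertices G}).
Proof.
move=> clS x y /[!inE] xS yS ne_xy.
apply: (@dpg_edge_Some _ (matching m)); apply: (@chooser_edge _ m i).
exact: clS.
Qed.

Lemma card_preim_Some (T : finType) (S : {set option T}) :
  #|S| = (None \in S) + #|Some @^-1: S|.
Proof.
rewrite (cardsD1 None) -(card_imset (Some @^-1: S) Some_inj); congr (_ + _).
apply: eq_card => -[x|]; rewrite !inE /=.
  by rewrite mem_imset ?inE //; exact: Some_inj.
by apply/esym/imsetP=> -[].
Qed.

Lemma cliques_below_step (G : sgraph) (m : builder_move G) (i : bool)
    (n : nat) :
  cliques_below G n -> cliques_below (chooser_select m i) n.+1.
Proof.
move=> Gn S /clique_preim/Gn lt_n; rewrite card_preim_Some ltnS.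
exact: leq_trans (leq_add (leq_b1 _) (leqnn _)) lt_n.
Qed.

(** Without [None], the preimage of [S] would be a clique of [G] of the same size, hence too
    large. *)
Lemma new_vertex_in_clique (G : sgraph) (m : builder_move G) (i : bool)
    (n : nat) (S : {set vertices (chooser_select m i)}) :
  cliques_below G n -> is_clique S -> n <= #|S| -> None \in S.
Proof.
move=> Gn /clique_preim/Gn; rewrite card_preim_Some ltnNge.
by case: (None \in S) => // /negP.
Qed.

Lemma cliques_below_two_steps (G : sgraph) (n : nat) (m1 : builder_move G)
    (i : bool) (m2 : builder_move (chooser_select m1 i)) :
  cliques_below G n -> exists j, cliques_below (chooser_select m2 j) n.+1.
Proof.
(* After two rounds [None] is the vertex of the second round, and [Some None] that of the first. *)
move=> Gn; pose w1w2 : {set option (option (vertices G))} :=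
  [set None; Some None].
have w1w2_avoid j : w1w2 \notin part m2 j ->
    cliques_below (chooser_select m2 j) n.+1.
  move=> w1w2j S clS; rewrite ltnNge; apply: contra w1w2j => lt_nS.
  have w2S : None \in S.
    exact: new_vertex_in_clique (cliques_below_step Gn) clS lt_nS.
  have w1S : Some None \in S.
    (* Dropping the second new vertex from [S] leaves a clique of at least [n] vertices in the graph
       after round one, so it contains the first new vertex. *)
    suff: None \in Some @^-1: S by rewrite inE.
    apply: new_vertex_in_clique Gn (clique_preim clS) _.
    by rewrite card_preim_Some w2S in lt_nS.
  exact: clS.
have [in0|out0] := boolP (w1w2 \in part m2 false); last first.
  by exists false; exact: w1w2_avoid.
exists true; apply: w1w2_avoid.
by rewrite (disjointFr (part_disjoint m2) in0).
Qed.

(** Against a fixed [s], Chooser's play is a single answer sequence. Only the answer of round 2, at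
    index 1, has to be chosen with care. *)
Lemma Chooser_bounds_cliques (s : builder_strategy) (G : sgraph) (n : nat) :
  cliques_below G n ->
  exists c, cliques_below (game_graph s G c 1) n.+1 /\
    forall t, cliques_below (game_graph s G c t.+2) (n + t).+1.
Proof.
move=> Gn; pose G1 := chooser_select (s [::] G) false.
(* [[:: false]] is the history that [s] sees in round 2 once the first answer is [false]. *)
have [j G2n] := cliques_below_two_steps (s [:: false] G1) Gn.
exists (fun t => if t == 1 then j else false); split.
  exact: cliques_below_step.
elim=> [|t IHt]; first by rewrite addn0.
by rewrite addnS; exact: cliques_below_step.
Qed.

Theorem theorem6p3 (r : nat) (hr : 3 <= r) (G0 : sgraph)
    (hG0 : ~ contains_subgraph G0 (complete_graph r)) (k : nat)
    (hk : r + 1 <= k) :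
  leq_infty (k - r + 2) (forcing_time (complete_graph k) G0).
Proof.
rewrite /forcing_time; case: pselect => //= forced.
case: ex_minnP => T /asboolP[s forces] _; rewrite leqNgt; apply/negP => ltT.
have /cliques_belowP G0r := hG0.
have [c [G1r Gtr]] := Chooser_bounds_cliques s G0r.
have [t le_tT] := forces c; apply/cliques_belowP.
(* The saving appears only from round 2 on; rounds 0 and 1 are covered by [r < k]. *)
rewrite addn1 in hk; case: t le_tT => [|[|t]] le_tT.
- exact: cliques_below_leq (ltnW hk) G0r.
- exact: cliques_below_leq hk G1r.
(* From [t.+2 <= T < k - r + 2] follows [t.+1 <= k - r], so the bound [(r + t).+1] is at most
   [k]. *)
- apply: cliques_below_leq (Gtr t); rewrite -addnS -leq_subRL ?(ltnW hk) //.
  by have := leq_ltn_trans le_tT ltT; rewrite addn2.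
Qed.
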